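(* Let $n \ge 0$ and $t$ be integers, let $s \in \mathbf{F}$ with $s \in [0,1]$, let $b_0 \in \mathbf{F}$ with $b_0 \ne 0$, and let $p$ be the polynomial $p(s) = b_0\left[(1-s) - 2^t s\right]^n$, i.e. the polynomial with Bernstein coefficients $b_j = (-2^t)^j b_0$, $j = 0,\ldots,n$. Assume $(1-s) - 2^t s \neq 0$, and that no overflow or underflow occurs (so in particular $-2^t$ and all $b_j$ belong to $\mathbf{F}$). Then the value computed by the de Casteljau algorithm in floating point arithmetic satisfies $$\frac{\left|p(s) - \mathtt{DeCasteljau}(p, s)\right|}{\left|p(s)\right|} \leq \left(1 + \left|\phi\right| \gamma_3\right)^n - 1,$$ where $$\phi := \frac{(1 - s) + 2^t s}{(1 - s) - 2^t s} = \frac{1 + \left(2^t - 1\right) s}{1 - \left(2^t + 1\right) s}.$$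
   Context: Floating point arithmetic. $\mathbf{F} \subset \mathbb{R}$ is the set of floating point numbers of a binary (base 2) floating point arithmetic with unit round-off $\mathbf{u} > 0$ (for IEEE-754 double precision, $\mathbf{u} = 2^{-53}$). For $a, b \in \mathbf{F}$ and $\circ \in \{+,-,\times,\div\}$, the corresponding floating point operation $\star \in \{\oplus,\ominus,\otimes,\oslash\}$ returns an element of $\mathbf{F}$ with $a \star b = (a \circ b)(1+\delta_1) = (a\circ b)/(1+\delta_2)$ for some $|\delta_1|, |\delta_2| \le \mathbf{u}$. Moreover, in the absence of overflow and underflow, multiplication by $-2^t$ is exact, and for $a, b, -2^t \in \mathbf{F}$ one has $(-2^t a)\otimes b = -2^t (a \otimes b)$ and $(-2^t a) \oplus (-2^t b) = -2^t(a \oplus b)$. For an integer $m\ge 0$ with $m\mathbf{u} < 1$, $\gamma_m := m\mathbf{u}/(1 - m\mathbf{u})$; it is assumed that $3\mathbf{u}<1$. Bernstein form. $B_{j,n}(s) = \binom{n}{j}(1-s)^{n-j}s^j$, and a polynomial with Bernstein coefficients $b_0,\ldots,b_n$ is $p(s) = \sum_{j=0}^n b_j B_{j,n}(s)$. De Casteljau algorithm. Given $b_0,\ldots,b_n \in \mathbf{F}$ and $s \in \mathbf{F}$, set $\widehat{r} = 1 \ominus s$ and $\widehat{b}_j^{(n)} = b_j$ for $j = 0,\ldots,n$; for $k = n-1,\ldots,0$ and $j = 0,\ldots,k$ set $\widehat{b}_j^{(k)} = \left(\widehat{r} \otimes \widehat{b}_j^{(k+1)}\right) \oplus \left(s \otimes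 \widehat{b}_{j+1}^{(k+1)}\right)$. The result is $\mathtt{DeCasteljau}(p,s) := \widehat{b}_0^{(0)}$. *)

(* Defs.v *)
From HB Require Import structures.
From mathcomp Require Import all_boot all_order all_algebra.
From mathcomp Require Import reals.

Set Implicit Arguments.
Unset Strict Implicit.
Unset Printing Implicit Defensive.

Import Order.TTheory GRing.Theory Num.Theory.
Local Open Scope ring_scope.

Variant fop := FAdd | FSub | FMul | FDiv.

Definition exact_op (R : realType) (o : fop) (a b : R) : R :=
  match o with
  | FAdd => a + b
  | FSub => a - b
  | FMul => a * b
  | FDiv => a / b
  end.

(* Axiomatic model of a binary floating point arithmetic.  [fp_safe o a b]
   means that the floating point evaluation of [a o b] neither overflows nor
   underflows; nothing is assumed about the result of an operation that is not
   safe, so bounded exponent ranges are covered.  The unit round-off is not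
   tied to the precision: this allows any rounding mode compatible with the
   exactness of scaling by [- 2 ^ t].
   The scaling law for the product is assumed for either factor, because the
   other axioms do not make the floating point product commutative. *)
Record fp_arith (R : realType) := FpArith {
  fp_num : R -> Prop;
  fp_prec : nat;
  fp_u : R;
  fp_op : fop -> R -> R -> R;
  fp_safe : fop -> R -> R -> Prop;
  fp_u_gt0 : 0 < fp_u;
  fp_num_binary : forall x : R, fp_num x ->
    exists m e : int, `|m| < 2 ^+ fp_prec /\ x = m%:~R * 2 ^ e;
  fp_num1 : fp_num 1;
  fp_op_num : forall (o : fop) (a b : R),
    fp_num a -> fp_num b -> (o = FDiv -> b != 0) -> fp_safe o a b ->
    fp_num (fp_op o a b);
  fp_op_model : forall (o : fop) (a b : R),
    fp_num a -> fp_num b -> (o = FDiv -> b != 0) -> fp_safe o a b ->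
    exists d1 d2 : R,
      [/\ `|d1| <= fp_u, `|d2| <= fp_u,
          fp_op o a b = exact_op o a b * (1 + d1) &
          fp_op o a b = exact_op o a b / (1 + d2)];
  fp_scale_exact : forall (t : int) (a : R),
    fp_num (- 2 ^ t) -> fp_num a -> fp_safe FMul (- 2 ^ t) a ->
    fp_op FMul (- 2 ^ t) a = - 2 ^ t * a;
  fp_scale_mull : forall (t : int) (a b : R),
    fp_num (- 2 ^ t) -> fp_num a -> fp_num b -> fp_num (- 2 ^ t * a) ->
    fp_safe FMul a b -> fp_safe FMul (- 2 ^ t * a) b ->
    fp_op FMul (- 2 ^ t * a) b = - 2 ^ t * fp_op FMul a b;
  fp_scale_mulr : forall (t : int) (a b : R),
    fp_num (- 2 ^ t) -> fp_num a -> fp_num b -> fp_num (- 2 ^ t * b) ->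
    fp_safe FMul a b -> fp_safe FMul a (- 2 ^ t * b) ->
    fp_op FMul a (- 2 ^ t * b) = - 2 ^ t * fp_op FMul a b;
  fp_scale_add : forall (t : int) (a b : R),
    fp_num (- 2 ^ t) -> fp_num a -> fp_num b ->
    fp_num (- 2 ^ t * a) -> fp_num (- 2 ^ t * b) ->
    fp_safe FAdd a b -> fp_safe FAdd (- 2 ^ t * a) (- 2 ^ t * b) ->
    fp_op FAdd (- 2 ^ t * a) (- 2 ^ t * b) = - 2 ^ t * fp_op FAdd a b
}.

Definition fp_gamma (R : realType) (A : fp_arith R) (m : nat) : R :=
  m%:R * fp_u A / (1 - m%:R * fp_u A).

Definition bernstein (R : realType) (n j : nat) : {poly R} :=
  ('C(n, j)%:R)%:P * (1 - 'X) ^+ (n - j) * 'X^j.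

(* Only the coefficients [b 0], ..., [b n] matter. *)
Definition bernstein_form (R : realType) (n : nat) (b : nat -> R) : {poly R} :=
  \sum_(j < n.+1) (b j)%:P * bernstein R n j.

(* [dc_coef A b s m j] is the coefficient of index [j] after [m] passes, that is
   at level [k = n - m] of the usual decreasing numbering; it is part of the de
   Casteljau triangle of degree [n] when [j <= n - m]. *)
Fixpoint dc_coef (R : realType) (A : fp_arith R) (b : nat -> R) (s : R)
    (m j : nat) : R :=
  if m is m'.+1 then
    fp_op A FAdd
      (fp_op A FMul (fp_op A FSub 1 s) (dc_coef A b s m' j))
      (fp_op A FMul s (dc_coef A b s m' j.+1))
  else b j.

Definition DeCasteljau (R : realType) (A : fp_arith R) (n : nat)
    (b : nat -> R) (s : R) : R :=
  dc_coef A b s n 0.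

(* No operation performed by the algorithm overflows or underflows. *)
Definition DeCasteljau_safe (R : realType) (A : fp_arith R) (n : nat)
    (b : nat -> R) (s : R) : Prop :=
  let r := fp_op A FSub 1 s in
  fp_safe A FSub 1 s /\
  forall m j : nat, (m < n)%N -> (j <= n - m.+1)%N ->
    let x := dc_coef A b s m j in
    let y := dc_coef A b s m j.+1 in
    [/\ fp_safe A FMul r x, fp_safe A FMul s y &
        fp_safe A FAdd (fp_op A FMul r x) (fp_op A FMul s y)].

(* Main.v *)
Require Import Defs.
From HB Require Import structures.
From mathcomp Require Import all_boot all_order all_algebra.
From mathcomp Require Import reals.
From mathcomp Require Import ring lra zify.

(** The coefficients [(- 2 ^ t) ^+ j * b0] form a geometric progression whose
    ratio [- 2 ^ t] scales floating point numbers without rounding.  Every pass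
    of the algorithm combines neighbours with the same two weights, so the
    computed coefficients of every level are still exactly geometric
    ([dc_coef_geometric]).  The whole triangle is therefore governed by its
    first entries [w_m], and each pass amounts to evaluating
    [w_(m+1) = (1 - s) w_m - s 2 ^ t w_m], whose exact value is [q w_m] with
    [q = (1 - s) - 2 ^ t s].

    Each of the two products in that sum carries at most three rounding errors:
    the one of [1 - s], the one of the product and the one of the sum.  Hence
    the error of a pass is at most [gamma_3 ((1 - s) + 2 ^ t s) |w_m|]
    ([dc_step_error]), which is [|q| |phi| gamma_3 |w_m|]: the number [phi]
    is the ratio between the sum of the absolute values of the two terms and
    their actual sum.  A pass thus multiplies by [q] up to a relative error
    [|phi| gamma_3], and these errors compound like interest over [n] passes
    ([perturbed_power_error]). *)

Import Order.TTheory GRing.Theory Num.Theory.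
Local Open Scope ring_scope.

Lemma bernstein_form_geometric (R : realType) (n : nat) (c a x : R) :
  (bernstein_form n (fun j => c ^+ j * a)).[x] = a * ((1 - x) + c * x) ^+ n.
Proof.
rewrite exprDn mulr_sumr horner_sum; apply: eq_bigr => j _.
rewrite /bernstein !hornerE /= exprMn.
ring.
Qed.

(** The bound grows from [g_m] to at most [g_m (1 + u) + u], and
    [g_m (1 + u) + u = (m + 1) u / (1 - m u)], which is below [g_(m+1)]. *)
Lemma prod_rounding_le_gamma (R : realType) (A : fp_arith R) (ds : seq R) :
  (size ds)%:R * fp_u A < 1 -> all (fun d => `|d| <= fp_u A) ds ->
  `|\prod_(d <- ds) (1 + d) - 1| <= fp_gamma A (size ds).
Proof.
rewrite /fp_gamma; have u_gt0 := fp_u_gt0 A; move: (fp_u A) u_gt0 => u u_gt0.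
elim: ds => [|d ds IHds] /=.
  by move=> _ _; rewrite big_nil subrr normr0 mul0r mul0r.
rewrite -natr1 => msu /andP[hd /IHds {}IHds].
move: (size ds)%:R (ler0n R (size ds)) msu IHds => m m_ge0 msu IHds.
have IH : `|\prod_(e <- ds) (1 + e) - 1| <= m * u / (1 - m * u).
  by apply: IHds; nra.
rewrite big_cons; set P := \prod_(e <- ds) (1 + e) in IH *.
have -> : (1 + d) * P - 1 = (P - 1) * (1 + d) + d by ring.
apply: (le_trans (ler_normD _ _)); rewrite normrM.
have d1 : `|1 + d| <= 1 + u.
  by apply: (le_trans (ler_normD _ _)); rewrite normr1 lerD2l.
apply: (@le_trans _ _ (m * u / (1 - m * u) * (1 + u) + u)).
  by apply: lerD => //; apply: ler_pM.
have h0 : 0 < 1 - m * u by nra.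
have h1 : 0 < 1 - (m + 1) * u by nra.
have -> : m * u / (1 - m * u) * (1 + u) + u = (m + 1) * u / (1 - m * u).
  by field; lra.
apply: ler_wpM2l; first by nra.
by rewrite lef_pV2 ?posrE //; nra.
Qed.

Lemma fp_op_rounding {R : realType} {A : fp_arith R} {o : fop} {a b : R} :
  o <> FDiv -> fp_num A a -> fp_num A b -> fp_safe A o a b ->
  fp_num A (fp_op A o a b) /\
  exists2 d, `|d| <= fp_u A & fp_op A o a b = exact_op o a b * (1 + d).
Proof.
move=> oDiv aF bF safe; split; first exact: fp_op_num.
by have [//|d [_ [hd _ -> _]]] := fp_op_model aF bF _ safe; exists d.
Qed.

(** The exact sum splits into two terms of absolute values [(1 - s) |w|] and
    [s |c w|].  The rounding of [1 - s] affects only the first of them, so the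
    second one uses two of the three roundings that [gamma_3] pays for. *)
Lemma dc_step_error {R : realType} {A : fp_arith R} {s c w : R} :
  let r := fp_op A FSub 1 s in
  3 * fp_u A < 1 -> 0 <= s <= 1 ->
  fp_num A s -> fp_num A w -> fp_num A (c * w) ->
  fp_safe A FSub 1 s -> fp_safe A FMul r w -> fp_safe A FMul s (c * w) ->
  fp_safe A FAdd (fp_op A FMul r w) (fp_op A FMul s (c * w)) ->
  `|fp_op A FAdd (fp_op A FMul r w) (fp_op A FMul s (c * w))
    - ((1 - s) + c * s) * w|
  <= ((1 - s) + `|c| * s) * fp_gamma A 3 * `|w|.
Proof.
move=> r hu /andP[s0 s1] sF wF cwF safe_r safe_rw safe_sw safe_add.
have [//|rF [d0 hd0 Er]] := fp_op_rounding _ (fp_num1 A) sF safe_r.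
have [//|rwF [d1 hd1 Erw]] := fp_op_rounding _ rF wF safe_rw.
have [//|swF [d2 hd2 Esw]] := fp_op_rounding _ sF cwF safe_sw.
have [//|_ [d3 hd3 ->]] := fp_op_rounding _ rwF swF safe_add.
rewrite /= in Erw Esw *; rewrite Erw Esw /r Er /=.
have h1 : `|\prod_(d <- [:: d0; d1; d3]) (1 + d) - 1| <= fp_gamma A 3.
  by apply: prod_rounding_le_gamma => //=; rewrite hd0 hd1 hd3.
have h2 : `|\prod_(d <- [:: 0; d2; d3]) (1 + d) - 1| <= fp_gamma A 3.
  apply: prod_rounding_le_gamma => //=.
  by rewrite normr0 ltW ?fp_u_gt0 // hd2 hd3.
move: h1 h2; rewrite !big_cons !big_nil.
set e1 := (X in `|X| <= _ -> _); set e2 := (X in _ -> `|X| <= _ -> _) => h1 h2.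
have -> : ((1 - s) * (1 + d0) * w * (1 + d1) + s * (c * w) * (1 + d2))
            * (1 + d3) - ((1 - s) + c * s) * w
          = (1 - s) * e1 * w + c * s * e2 * w by rewrite /e1 /e2; ring.
have r0 : 0 <= 1 - s by rewrite subr_ge0.
apply: (le_trans (ler_normD _ _)).
rewrite !normrM (ger0_norm s0) (ger0_norm r0).
have -> : ((1 - s) + `|c| * s) * fp_gamma A 3 * `|w|
    = (1 - s) * fp_gamma A 3 * `|w| + `|c| * s * fp_gamma A 3 * `|w| by ring.
by apply: lerD; rewrite ler_wpM2r ?ler_wpM2l ?mulr_ge0.
Qed.

(** Scaling by [- 2 ^ t] commutes with each rounded operation, so a row in
    geometric progression is mapped to another one.  Membership in the floating
    point numbers is carried along because the scaling laws require it. *)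
Lemma dc_coef_geometric {R : realType} {A : fp_arith R} {n : nat} {t : int}
    {s : R} {b : nat -> R} :
  fp_num A s -> fp_num A (- 2 ^ t) ->
  (forall j, (j <= n)%N -> fp_num A (b j)) ->
  (forall j, (j < n)%N -> b j.+1 = - 2 ^ t * b j) ->
  DeCasteljau_safe A n b s ->
  forall m, (m <= n)%N ->
    (forall j, (j <= n - m)%N -> fp_num A (dc_coef A b s m j)) /\
    (forall j, (j < n - m)%N ->
       dc_coef A b s m j.+1 = - 2 ^ t * dc_coef A b s m j).
Proof.
move=> sF tF bF bgeo [safe_r safe].
have [//|rF _] := fp_op_rounding _ (fp_num1 A) sF safe_r.
elim=> [|m IHm] lt_mn.
  by rewrite subn0; split=> j /=; [apply: bF | apply: bgeo].
have [xF geo] := IHm (ltnW lt_mn).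
have subS j : (j <= n - m.+1)%N -> (j < n - m)%N by lia.
have rxF j : (j <= n - m.+1)%N ->
    fp_num A (fp_op A FMul (fp_op A FSub 1 s) (dc_coef A b s m j)).
  move=> jle; have [h _ _] := safe m j lt_mn jle.
  by have [|//] := fp_op_rounding _ rF (xF _ (ltnW (subS _ jle))) h.
have syF j : (j <= n - m.+1)%N ->
    fp_num A (fp_op A FMul s (dc_coef A b s m j.+1)).
  move=> jle; have [_ h _] := safe m j lt_mn jle.
  by have [|//] := fp_op_rounding _ sF (xF _ (subS _ jle)) h.
split=> j jle /=.
  have [_ _ h] := safe m j lt_mn jle.
  by have [|//] := fp_op_rounding _ (rxF _ jle) (syF _ jle) h.
have [safe_x safe_y safe_add] := safe m j lt_mn (ltnW jle).
have [safe_x' safe_y' safe_add'] := safe m j.+1 lt_mn jle.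
have jm : (j < n - m)%N := subS _ (ltnW jle).
have j1m : (j.+1 < n - m)%N := subS _ jle.
have Erx : fp_op A FMul (fp_op A FSub 1 s) (dc_coef A b s m j.+1) =
    - 2 ^ t * fp_op A FMul (fp_op A FSub 1 s) (dc_coef A b s m j).
  rewrite {1}(geo _ jm); apply: fp_scale_mulr => //; rewrite -?(geo _ jm) //.
  - exact: xF (ltnW jm).
  - exact: xF.
have Esy : fp_op A FMul s (dc_coef A b s m j.+2) =
    - 2 ^ t * fp_op A FMul s (dc_coef A b s m j.+1).
  rewrite {1}(geo _ j1m); apply: fp_scale_mulr => //; rewrite -?(geo _ j1m) //.
  - exact: xF.
  - exact: xF.
rewrite Erx Esy; apply: fp_scale_add => //; rewrite -?Erx -?Esy //.
- exact: rxF (ltnW jle).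
- exact: syF (ltnW jle).
- exact: rxF.
- exact: syF.
Qed.

(** With [Q = |q| ^ m |w_0|], the bound gives [|w_m| <= Q (1 + e) ^ m]; the next
    step adds [|q| e |w_m|] to [|q|] times the accumulated error, and
    [e (1 + e) ^ m + ((1 + e) ^ m - 1) = (1 + e) ^ m.+1 - 1]. *)
Lemma perturbed_power_error {R : realType} (q e : R) (w : nat -> R) (n : nat) :
  0 <= e ->
  (forall m, (m < n)%N -> `|w m.+1 - q * w m| <= `|q| * e * `|w m|) ->
  `|w n - q ^+ n * w 0| <= `|q ^+ n * w 0| * ((1 + e) ^+ n - 1).
Proof.
move=> e0; elim: n => [|n IHn] step.
  by rewrite !expr0 mul1r !subrr normr0 mulr0.
have IH := IHn (fun m lt_mn => step m (ltnW lt_mn)).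
have wn : `|w n| <= `|q ^+ n * w 0| * (1 + e) ^+ n.
  have -> : w n = (w n - q ^+ n * w 0) + q ^+ n * w 0 by ring.
  by apply: (le_trans (ler_normD _ _)); lra.
have -> : w n.+1 - q ^+ n.+1 * w 0
    = (w n.+1 - q * w n) + q * (w n - q ^+ n * w 0) by rewrite exprS; ring.
apply: (le_trans (ler_normD _ _)); rewrite normrM.
apply: (@le_trans _ _ (`|q| * e * (`|q ^+ n * w 0| * (1 + e) ^+ n)
                       + `|q| * (`|q ^+ n * w 0| * ((1 + e) ^+ n - 1)))).
  apply: lerD; last exact: ler_wpM2l.
  by apply: (le_trans (step n (ltnSn n))); apply: ler_wpM2l => //;
     apply: mulr_ge0.
have -> : `|q ^+ n.+1 * w 0| = `|q| * `|q ^+ n * w 0|.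
  by rewrite -normrM mulrA -exprS.
by rewrite [(1 + e) ^+ n.+1]exprS; lra.
Qed.

Theorem theorem3p1 (R : realType) (A : fp_arith R) (hu : 3 * fp_u A < 1)
    (n : nat) (t : int) (s b0 : R)
    (hsF : fp_num A s) (hs : 0 <= s <= 1)
    (hb0F : fp_num A b0) (hb0 : b0 != 0)
    (hne : (1 - s) - 2 ^ t * s != 0)
    (htF : fp_num A (- 2 ^ t))
    (hbF : forall j : nat, (j <= n)%N -> fp_num A ((- 2 ^ t) ^+ j * b0))
    (hsafe : DeCasteljau_safe A n (fun j : nat => (- 2 ^ t) ^+ j * b0) s) :
  let b := fun j : nat => (- 2 ^ t) ^+ j * b0 in
  let p := bernstein_form n b in
  let phi := ((1 - s) + 2 ^ t * s) / ((1 - s) - 2 ^ t * s) in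
  [/\ forall x : R, p.[x] = b0 * ((1 - x) - 2 ^ t * x) ^+ n,
      phi = (1 + (2 ^ t - 1) * s) / (1 - (2 ^ t + 1) * s) &
      `|p.[s] - DeCasteljau A n b s| / `|p.[s]|
        <= (1 + `|phi| * fp_gamma A 3) ^+ n - 1].
Proof.
move=> b p phi.
have bgeo j : b j.+1 = - 2 ^ t * b j by rewrite /b exprS mulrA.
have pE x : p.[x] = b0 * ((1 - x) - 2 ^ t * x) ^+ n.
  by rewrite /p bernstein_form_geometric mulNr.
split=> //; first by rewrite /phi; congr (_ / _); ring.
have [s0 s1] := andP hs; have [safe_r safe] := hsafe.
have T0 : 0 < 2 ^ t :> R by rewrite exprz_gt0.
set q := (1 - s) - 2 ^ t * s in hne phi pE *.
have phi_q : `|q| * `|phi| = (1 - s) + 2 ^ t * s.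
  rewrite -normrM /phi mulrCA divff // mulr1 ger0_norm //.
  by apply: addr_ge0; [rewrite subr_ge0 | apply: mulr_ge0 => //; apply: ltW].
have gamma_ge0 : 0 <= fp_gamma A 3.
  rewrite /fp_gamma; apply: divr_ge0; last by rewrite subr_ge0 ltW.
  by rewrite mulr_ge0 ?ltW ?fp_u_gt0.
have step m : (m < n)%N ->
    `|dc_coef A b s m.+1 0 - q * dc_coef A b s m 0|
    <= `|q| * (`|phi| * fp_gamma A 3) * `|dc_coef A b s m 0|.
  move=> lt_mn.
  have [wF geo] := dc_coef_geometric hsF htF hbF (fun j _ => bgeo j) hsafe
    m (ltnW lt_mn).
  have nm_gt0 : (0 < n - m)%N by rewrite subn_gt0.
  have [safe_x safe_y safe_add] := safe m 0 lt_mn (leq0n _).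
  have w1F := wF 1 nm_gt0.
  rewrite [dc_coef A b s m.+1 0]/= mulrA phi_q.
  rewrite (geo 0 nm_gt0) in safe_y safe_add w1F *.
  have := dc_step_error hu hs hsF (wF 0 (leq0n _)) w1F
    safe_r safe_x safe_y safe_add.
  by rewrite normrN (gtr0_norm T0) [_ + - 2 ^ t * s](_ : _ = q) // mulNr.
have err := perturbed_power_error q _ (fun m => dc_coef A b s m 0) n
  (mulr_ge0 (normr_ge0 phi) gamma_ge0) step.
rewrite pE ler_pdivrMr ?normr_gt0 ?mulf_neq0 ?expf_neq0 //.
move: err => /=; rewrite [b 0]mul1r distrC => err.
by rewrite [leRHS]mulrC (mulrC b0).
Qed.
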